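(* Let $n\geq 1$, let $S$ be a left-handed skew Boolean intersection algebra and assume that $X_n=\{x_1,x_2,\dots,x_n\}\subseteq S$ is a subset with $n$ elements. The following statements are equivalent: (1) The subalgebra $\langle X_n\rangle$ of $S$ is free over $X_n$ (in the variety of left-handed skew Boolean intersection algebras). (2) All elementary elements $e(X_n,\alpha,A)$ over $X_n$ are non-zero. (3) All elementary elements $e(X_n,\alpha,A)$ over $X_n$ are non-zero and pairwise distinct (for distinct pointed partitions $(X_n,\alpha,A)$).
   Context: A skew Boolean algebra (SBA) is an algebra $(S;\wedge,\vee,\setminus,0)$ of type $(2,2,2,0)$ satisfying: $\wedge$ and $\vee$ are associative; $x\vee(x\wedge y)=x=(y\wedge x)\vee x$ and $x\wedge(x\vee y)=x=(y\vee x)\wedge x$; $x\wedge(y\vee z)=(x\wedge y)\vee(x\wedge z)$ and $(y\vee z)\wedge x=(y\wedge x)\vee(z\wedge x)$; $x\vee 0=0\vee x=x$ and $x\wedge 0=0\wedge x=0$; $(x\setminus y)\wedge y=y\wedge(x\setminus y)=0$ and $(x\setminus y)\vee(x\wedge y\wedge x)=x=(x\wedge y\wedge x)\vee(x\setminus y)$; $x\wedge y\wedge z\wedge t=x\wedge z\wedge y\wedge t$. It is left-handed if also $x\wedge y\wedge x=x\wedge y$ and $x\vee y\vee x=y\vee x$. The natural partial order is: $x\leq y$ iff $x\wedge y=y\wedge x=x$. An SBA has intersections if any two elements $x,y$ have a greatest lower bound $x\sqcap y$ with respect to $\leq$; a (left-handed) skew Boolean intersection algebra (SBIA) is an algebra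 $(S;\wedge,\vee,\setminus,\sqcap,0)$ where $(S;\wedge,\vee,\setminus,0)$ is a (left-handed) SBA with intersections and $\sqcap$ is this meet operation. Left-handed SBIAs form a variety in the signature $(\wedge,\vee,\setminus,\sqcap,0)$, and subalgebras are taken in this signature. A partition $\alpha$ of a set is a partition into non-empty blocks; $A\in\alpha$ means $A$ is a block. Elementary elements: let $X$ be a finite non-empty subset of a left-handed SBIA $S$, $\alpha=\{A_1,\dots,A_k\}$ a partition of a non-empty subset $Y$ of $X$, and $A\in\alpha$ (then $(X,\alpha,A)$ is called a pointed partition). For a finite non-empty $B\subseteq S$, $\sqcap B$ denotes the $\sqcap$-meet of all elements of $B$, and $s\setminus(\vee B)$ denotes $s\setminus(b_1\vee\dots\vee b_r)$ where $b_1,\dots,b_r$ are the elements of $B$ (this does not depend on the order); $s\setminus(\vee\varnothing)=s$. Put $p=(\sqcap A)\wedge(\sqcap A_1)\wedge\dots\wedge(\sqcap A_k)$ and $Q=(X\setminus Y)\cup\{\sqcap(A_i\cup A_j)\colon 1\leq i<j\leq k\}$ ($X\setminus Y$ is set difference). Then $e(X,\alpha,A)=p\setminus(\vee Q)$; these are the elementary elements over $X$. *)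

(* Defs.v *)
From HB Require Import structures.
From Stdlib Require Import ProofIrrelevance.
From mathcomp Require Import all_boot.

Set Implicit Arguments.
Unset Strict Implicit.
Unset Printing Implicit Defensive.

Declare Scope sba_scope.
Delimit Scope sba_scope with sba.
Local Open Scope sba_scope.

Reserved Notation "x ⋏ y" (at level 40, left associativity).
Reserved Notation "x ⋎ y" (at level 50, left associativity).
Reserved Notation "x ∖ y" (at level 45, left associativity).
Reserved Notation "x ⊓ y" (at level 42, left associativity).
Reserved Notation "x ⊑ y" (at level 70, no associativity).

HB.mixin Record isSkewBoolean (S : Type) := {
  smeet : S -> S -> S;
  sjoin : S -> S -> S;
  sdiff : S -> S -> S;
  szero : S;
  smeetA : associative smeet;
  sjoinA : associative sjoin;
  sjoin_meetK : forall x y, sjoin x (smeet x y) = x;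
  sjoin_meetKr : forall x y, sjoin (smeet y x) x = x;
  smeet_joinK : forall x y, smeet x (sjoin x y) = x;
  smeet_joinKr : forall x y, smeet (sjoin y x) x = x;
  smeetDr : forall x y z, smeet x (sjoin y z) = sjoin (smeet x y) (smeet x z);
  smeetDl : forall x y z, smeet (sjoin y z) x = sjoin (smeet y x) (smeet z x);
  sjoinx0 : forall x, sjoin x szero = x;
  sjoin0x : forall x, sjoin szero x = x;
  smeetx0 : forall x, smeet x szero = szero;
  smeet0x : forall x, smeet szero x = szero;
  sdiff_meet : forall x y, smeet (sdiff x y) y = szero;
  smeet_diff : forall x y, smeet y (sdiff x y) = szero;
  sdiff_join : forall x y, sjoin (sdiff x y) (smeet (smeet x y) x) = x;
  sjoin_diff : forall x y, sjoin (smeet (smeet x y) x) (sdiff x y) = x;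
  smeet_normal : forall x y z t,
    smeet (smeet (smeet x y) z) t = smeet (smeet (smeet x z) y) t
}.

#[short(type="skewBooleanType")]
HB.structure Definition SkewBoolean := { S of isSkewBoolean S }.

Notation "x ⋏ y" := (smeet x y) : sba_scope.
Notation "x ⋎ y" := (sjoin x y) : sba_scope.
Notation "x ∖ y" := (sdiff x y) : sba_scope.

HB.mixin Record isLeftHanded S of SkewBoolean S := {
  smeet_left : forall x y : S, x ⋏ y ⋏ x = x ⋏ y;
  sjoin_left : forall x y : S, x ⋎ y ⋎ x = y ⋎ x
}.

#[short(type="leftSkewBooleanType")]
HB.structure Definition LeftSkewBoolean :=
  { S of isLeftHanded S & SkewBoolean S }.

Definition sle (S : skewBooleanType) (x y : S) : Prop :=
  x ⋏ y = x /\ y ⋏ x = x.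

Notation "x ⊑ y" := (sle x y) : sba_scope.

HB.mixin Record hasIntersections S of SkewBoolean S := {
  scap : S -> S -> S;
  scap_lel : forall x y : S, scap x y ⊑ x;
  scap_ler : forall x y : S, scap x y ⊑ y;
  scap_glb : forall x y z : S, z ⊑ x -> z ⊑ y -> z ⊑ scap x y
}.

#[short(type="lsbiaType")]
HB.structure Definition LSBIA :=
  { S of hasIntersections S & LeftSkewBoolean S }.

Notation "x ⊓ y" := (scap x y) : sba_scope.

Record lsbia_hom (S T : lsbiaType) (h : S -> T) : Prop := LsbiaHom {
  hom_meet : forall a b, h (a ⋏ b) = h a ⋏ h b;
  hom_join : forall a b, h (a ⋎ b) = h a ⋎ h b;
  hom_diff : forall a b, h (a ∖ b) = h a ∖ h b;
  hom_cap  : forall a b, h (a ⊓ b) = h a ⊓ h b;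
  hom_zero : h szero = szero
}.

(* For an injective family x this is freeness over the subset {x i | i}. *)
Definition free_over (I : Type) (F : lsbiaType) (x : I -> F) : Prop :=
  forall (T : lsbiaType) (f : I -> T),
    exists h : F -> T,
      [/\ lsbia_hom h, forall i, h (x i) = f i
        & forall h' : F -> T,
            lsbia_hom h' -> (forall i, h' (x i) = f i) -> h' =1 h].

Section GeneratedSubalgebra.
Variables (I : Type) (S : lsbiaType) (x : I -> S).

Inductive generated : S -> Prop :=
| generated_gen i : generated (x i)
| generated_zero : generated szero
| generated_meet a b : generated a -> generated b -> generated (a ⋏ b)
| generated_join a b : generated a -> generated b -> generated (a ⋎ b)
| generated_diff a b : generated a -> generated b -> generated (a ∖ b)
| generated_cap a b : generated a -> generated b -> generated (a ⊓ b).

Definition subalg : Type := {s : S | generated s}.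

Definition subalg_gen (i : I) : subalg := exist _ (x i) (generated_gen i).

Lemma subalg_inj (a b : subalg) : sval a = sval b -> a = b.
Proof.
case: a b => [a ga] [b gb] /= eab; case: b / eab gb => gb.
by rewrite (proof_irrelevance _ ga gb).
Qed.

Definition subalg_zero : subalg := exist _ szero generated_zero.
Definition subalg_meet (a b : subalg) : subalg :=
  exist _ (sval a ⋏ sval b) (generated_meet (svalP a) (svalP b)).
Definition subalg_join (a b : subalg) : subalg :=
  exist _ (sval a ⋎ sval b) (generated_join (svalP a) (svalP b)).
Definition subalg_diff (a b : subalg) : subalg :=
  exist _ (sval a ∖ sval b) (generated_diff (svalP a) (svalP b)).
Definition subalg_cap (a b : subalg) : subalg :=
  exist _ (sval a ⊓ sval b) (generated_cap (svalP a) (svalP b)).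

Fact subalg_meetA : associative subalg_meet.
Proof. by move=> a b c; apply: subalg_inj; rewrite /= smeetA. Qed.
Fact subalg_joinA : associative subalg_join.
Proof. by move=> a b c; apply: subalg_inj; rewrite /= sjoinA. Qed.
Fact subalg_join_meetK a b : subalg_join a (subalg_meet a b) = a.
Proof. by apply: subalg_inj; rewrite /= sjoin_meetK. Qed.
Fact subalg_join_meetKr a b : subalg_join (subalg_meet b a) a = a.
Proof. by apply: subalg_inj; rewrite /= sjoin_meetKr. Qed.
Fact subalg_meet_joinK a b : subalg_meet a (subalg_join a b) = a.
Proof. by apply: subalg_inj; rewrite /= smeet_joinK. Qed.
Fact subalg_meet_joinKr a b : subalg_meet (subalg_join b a) a = a.
Proof. by apply: subalg_inj; rewrite /= smeet_joinKr. Qed.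
Fact subalg_meetDr a b c :
  subalg_meet a (subalg_join b c)
  = subalg_join (subalg_meet a b) (subalg_meet a c).
Proof. by apply: subalg_inj; rewrite /= smeetDr. Qed.
Fact subalg_meetDl a b c :
  subalg_meet (subalg_join b c) a
  = subalg_join (subalg_meet b a) (subalg_meet c a).
Proof. by apply: subalg_inj; rewrite /= smeetDl. Qed.
Fact subalg_joinx0 a : subalg_join a subalg_zero = a.
Proof. by apply: subalg_inj; rewrite /= sjoinx0. Qed.
Fact subalg_join0x a : subalg_join subalg_zero a = a.
Proof. by apply: subalg_inj; rewrite /= sjoin0x. Qed.
Fact subalg_meetx0 a : subalg_meet a subalg_zero = subalg_zero.
Proof. by apply: subalg_inj; rewrite /= smeetx0. Qed.
Fact subalg_meet0x a : subalg_meet subalg_zero a = subalg_zero.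
Proof. by apply: subalg_inj; rewrite /= smeet0x. Qed.
Fact subalg_diff_meet a b : subalg_meet (subalg_diff a b) b = subalg_zero.
Proof. by apply: subalg_inj; rewrite /= sdiff_meet. Qed.
Fact subalg_meet_diff a b : subalg_meet b (subalg_diff a b) = subalg_zero.
Proof. by apply: subalg_inj; rewrite /= smeet_diff. Qed.
Fact subalg_diff_join a b :
  subalg_join (subalg_diff a b) (subalg_meet (subalg_meet a b) a) = a.
Proof. by apply: subalg_inj; rewrite /= sdiff_join. Qed.
Fact subalg_join_diff a b :
  subalg_join (subalg_meet (subalg_meet a b) a) (subalg_diff a b) = a.
Proof. by apply: subalg_inj; rewrite /= sjoin_diff. Qed.
Fact subalg_meet_normal a b c d :
  subalg_meet (subalg_meet (subalg_meet a b) c) d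
  = subalg_meet (subalg_meet (subalg_meet a c) b) d.
Proof. by apply: subalg_inj; rewrite /= smeet_normal. Qed.

HB.instance Definition _ := isSkewBoolean.Build subalg
  subalg_meetA subalg_joinA subalg_join_meetK subalg_join_meetKr
  subalg_meet_joinK subalg_meet_joinKr subalg_meetDr subalg_meetDl
  subalg_joinx0 subalg_join0x subalg_meetx0 subalg_meet0x
  subalg_diff_meet subalg_meet_diff subalg_diff_join subalg_join_diff
  subalg_meet_normal.

Fact subalg_meet_left (a b : subalg) : a ⋏ b ⋏ a = a ⋏ b.
Proof. by apply: subalg_inj; rewrite /= smeet_left. Qed.
Fact subalg_join_left (a b : subalg) : a ⋎ b ⋎ a = b ⋎ a.
Proof. by apply: subalg_inj; rewrite /= sjoin_left. Qed.

HB.instance Definition _ :=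
  isLeftHanded.Build subalg subalg_meet_left subalg_join_left.

Lemma subalg_leE (a b : subalg) : a ⊑ b <-> sval a ⊑ sval b.
Proof.
split=> [[ab ba]|[ab ba]]; split.
- exact: (congr1 sval ab).
- exact: (congr1 sval ba).
- exact: subalg_inj.
- exact: subalg_inj.
Qed.

Fact subalg_cap_lel (a b : subalg) : subalg_cap a b ⊑ a.
Proof. by apply/subalg_leE; apply: scap_lel. Qed.
Fact subalg_cap_ler (a b : subalg) : subalg_cap a b ⊑ b.
Proof. by apply/subalg_leE; apply: scap_ler. Qed.
Fact subalg_cap_glb (a b c : subalg) :
  c ⊑ a -> c ⊑ b -> c ⊑ subalg_cap a b.
Proof. by move=> /subalg_leE ca /subalg_leE cb; apply/subalg_leE/scap_glb. Qed.

HB.instance Definition _ :=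
  hasIntersections.Build subalg subalg_cap_lel subalg_cap_ler subalg_cap_glb.

End GeneratedSubalgebra.

(* A subset X = {x i | i : I} of S is given by an injective family x, and the
   subsets of X are represented by the corresponding sets of indices. *)
Section Elementary.
Variables (I : finType) (S : lsbiaType) (x : I -> S).

(* alpha is a partition of Y := cover alpha; Y is non-empty because the block
   A is. *)
Definition pointed_partition (alpha : {set {set I}}) (A : {set I}) : bool :=
  partition alpha (cover alpha) && (A \in alpha).

(* Iterated operation over a non-empty list; the value on [::] is junk. *)
Definition fold1 (op : S -> S -> S) (l : seq S) : S :=
  if l is b :: l' then foldl op b l' else szero.

Definition bigcap_of (B : {set I}) : S := fold1 scap [seq x i | i in B].

Definition diff_joins (s : S) (l : seq S) : S :=
  if l is [::] then s else s ∖ fold1 sjoin l.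

(* The order of the blocks is immaterial: a ⋏ b ⋏ c = a ⋏ c ⋏ b holds in every
   left-handed skew Boolean algebra. *)
Definition elem_p (alpha : {set {set I}}) (A : {set I}) : S :=
  foldl smeet (bigcap_of A) [seq bigcap_of B | B in alpha].

(* A listing of the set Q. Elements of S may be repeated in it; this does not
   change s ∖ (⋎ Q), since a ⋎ b ⋎ a = b ⋎ a. *)
Definition elem_Q (alpha : {set {set I}}) : seq S :=
  [seq x i | i in ~: cover alpha] ++
  [seq bigcap_of D
     | D in [set B :|: C | B in alpha, C in alpha & B != C]].

Definition elementary (alpha : {set {set I}}) (A : {set I}) : S :=
  diff_joins (elem_p alpha A) (elem_Q alpha).

End Elementary.

(* Main.v *)
From HB Require Import structures.
Require Import Defs.
From mathcomp Require Import all_boot.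
From mathcomp Require Import boolp.

Set Implicit Arguments.
Unset Strict Implicit.
Unset Printing Implicit Defensive.

(* On an element e, a generator x i restricts to x i ⋏ e. An elementary element
   e = e(alpha, A) decides everything: x i ⋏ e is 0 off the cover of alpha, and
   otherwise it is e(alpha, B) for the block B of i; these restrictions lie
   in the same Green class as e and meet in 0 for distinct blocks. Hence:
   - (alpha, A) is read off the map i |-> x i ⋏ e when e <> 0;
   - sending i to its block is a map to a primitive algebra in which e(alpha, A)
     has the value A, so freeness makes e(alpha, A) non-zero;
   - conversely, a term that is non-zero under f : I -> T is non-zero on some
     non-zero w below it on which all f i ⊓ f j are decided; if alpha is the
     partition of the i with f i ⋏ w <> 0 according to f i ⋏ w, the value of the
     term on w and its value on e(alpha, A) in S come from the same generator,
     so the term is non-zero in S. Thus every equation between terms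
     that holds for x holds for f. *)

Local Open Scope sba_scope.

(** * Calculus of left-handed skew Boolean algebras *)

Section LeftSkewBoolean.
Variable S : leftSkewBooleanType.
Implicit Types x y z r : S.

Lemma smeetxx x : x ⋏ x = x.
Proof. by rewrite -{2}(sjoin_meetK x x) smeet_joinK. Qed.

(** Left-handedness appends a final [x]; then [y] and [z] are inner factors, which normality
    exchanges. *)
Lemma smeetAC x y z : x ⋏ y ⋏ z = x ⋏ z ⋏ y.
Proof.
rewrite -smeetA -(smeet_left x (y ⋏ z)) smeetA smeet_normal.
by rewrite -(smeetA x z) smeet_left smeetA.
Qed.

Lemma smeet_eq0C x y : x ⋏ y = szero -> y ⋏ x = szero.
Proof. by move=> xy0; rewrite -smeet_left -smeetA xy0 smeetx0. Qed.

Lemma sleE x y : x ⊑ y <-> y ⋏ x = x.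
Proof. by split=> [[]//|yx]; split=> //; rewrite -[in LHS]yx smeet_left. Qed.

Lemma sle_refl x : x ⊑ x.
Proof. by apply/sleE; rewrite smeetxx. Qed.

Lemma sle_anti x y : x ⊑ y -> y ⊑ x -> x = y.
Proof. by move=> [xy _] [_ yx]; rewrite -[LHS]xy. Qed.

Lemma sle_trans y x z : x ⊑ y -> y ⊑ z -> x ⊑ z.
Proof. by move=> /sleE xy /sleE yz; apply/sleE; rewrite -xy smeetA yz. Qed.

Lemma sle_meet x y : x ⋏ y ⊑ x.
Proof. by apply/sleE; rewrite smeetA smeetxx. Qed.

Lemma sjoin_eq0 x y : x ⋎ y = szero -> x = szero /\ y = szero.
Proof.
move=> xy0; split; first by rewrite -(smeet_joinK x y) xy0 smeetx0.
by rewrite -(smeet_joinKr y x) xy0 smeet0x.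
Qed.

Lemma sdiff_joinl x y : (x ∖ y) ⋎ (x ⋏ y) = x.
Proof. by have := sdiff_join x y; rewrite smeet_left. Qed.

Lemma sle_diff x y : x ∖ y ⊑ x.
Proof.
apply/sleE; rewrite -{1}(sdiff_joinl x y) smeetDl smeetxx -smeetA.
by rewrite smeet_diff smeetx0 sjoinx0.
Qed.

(** Two solutions [r], [r'] satisfy [r = r' ⋏ r] and [r' = r ⋏ r']: expand [x] as a join in [x ⋏ r]
    and in [x ⋏ r']. Both lie below [x], so by [smeetAC] they commute. *)
Lemma sdiff_unique x y r :
  r ⊑ x -> r ⋏ y = szero -> r ⋎ (x ⋏ y) = x -> r = x ∖ y.
Proof.
have half r1 r2 : r2 ⊑ x -> r2 ⋏ y = szero -> r1 ⋎ (x ⋏ y) = x ->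
    r2 = r1 ⋏ r2.
  move=> /sleE xr /smeet_eq0C yr r1x.
  by rewrite -{1}xr -r1x smeetDl -smeetA yr smeetx0 sjoinx0.
move=> rx ry rxy.
have r'x := sle_diff x y; have r'y := sdiff_meet x y.
rewrite (half _ _ rx ry (sdiff_joinl x y)) {2}(half _ _ r'x r'y rxy).
move/sleE: rx => xr; move/sleE: r'x => xr'.
by rewrite -[in LHS]xr' smeetAC xr.
Qed.

Lemma sdiffx0 x : x ∖ szero = x.
Proof.
symmetry; apply: sdiff_unique; first exact: sle_refl.
  exact: smeetx0.
by rewrite smeetx0 sjoinx0.
Qed.

Lemma smeet_diffA x y z : x ⋏ (y ∖ z) = (x ⋏ y) ∖ z.
Proof.
apply: sdiff_unique.
- apply/sleE; rewrite smeetA smeet_left -smeetA.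
  by case: (sle_diff y z) => _ ->.
- by rewrite -smeetA sdiff_meet smeetx0.
- by rewrite -smeetA -smeetDr sdiff_joinl.
Qed.

(** Restriction [_ ⋏ z] respects differences, as it respects joins by [smeetDl] and intersections by
    [scap_meetl]; the induction in [eval_decided] rests on this. *)
Lemma smeet_diffl x y z : (x ∖ y) ⋏ z = (x ⋏ z) ∖ (y ⋏ z).
Proof.
apply: sdiff_unique.
- apply/sleE; rewrite smeetA (smeetAC x) -(smeetA _ z z) smeetxx.
  by case: (sle_diff x y) => _ ->.
- by rewrite smeetA (smeetAC _ z) sdiff_meet !smeet0x.
- by rewrite smeetA (smeetAC x z) -(smeetA _ z z) smeetxx -smeetDl sdiff_joinl.
Qed.

(** The hypothesis is the preorder behind Green's relation; unlike [⊑], it can hold in both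
    directions between distinct elements. *)
Lemma sdiff_eq0 x y : x ⋏ y = x -> x ∖ y = szero.
Proof.
move=> xy; case: (sle_diff x y) => rx _.
by rewrite -[LHS]rx -[X in _ ⋏ X]xy smeetA rx sdiff_meet.
Qed.

Lemma sjoin_eqr x y : x ⋏ y = x -> x ⋎ y = y.
Proof. by move=> <-; rewrite sjoin_meetKr. Qed.

Lemma foldl_smeet_meetl y x (l : seq S) :
  y ⋏ foldl smeet x l = foldl smeet (y ⋏ x) l.
Proof. by elim: l x => //= a l IHl x; rewrite IHl smeetA. Qed.

Lemma foldl_smeet_meetr y x (l : seq S) :
  foldl smeet (x ⋏ y) l = foldl smeet x l ⋏ y.
Proof. by elim: l x => //= a l IHl x; rewrite smeetAC IHl. Qed.

Lemma foldl_smeet_absorb (J : eqType) (F : J -> S) x (s : seq J) j :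
  j \in s ->
  foldl smeet x [seq F i | i <- s] ⋏ F j = foldl smeet x [seq F i | i <- s].
Proof.
elim: s x => //= a s IHs x; rewrite inE => /predU1P [->|js]; last exact: IHs.
by rewrite -foldl_smeet_meetr -smeetA smeetxx.
Qed.

Lemma foldl_smeet_id (J : eqType) (F : J -> S) x (s : seq J) :
  (forall j, j \in s -> x ⋏ F j = x) -> foldl smeet x [seq F i | i <- s] = x.
Proof.
elim: s => //= a s IHs xF.
by rewrite xF ?mem_head// IHs// => j js; rewrite xF// inE js orbT.
Qed.

Lemma smeet_foldl_sjoin_eq0 (J : eqType) (F : J -> S) z x (s : seq J) :
  z ⋏ foldl sjoin x [seq F i | i <- s] = szero <->
  z ⋏ x = szero /\ forall j, j \in s -> z ⋏ F j = szero.
Proof.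
elim: s x => [|a s IHs] x /=; first by split=> [//|[]].
rewrite IHs smeetDr; split=> [[/sjoin_eq0 [zx za] zs]|[zx zs]].
  by split=> // j; rewrite inE => /predU1P [->//|/zs].
split; last by move=> j js; apply: zs; rewrite inE js orbT.
by rewrite zx zs ?mem_head// sjoinx0.
Qed.

End LeftSkewBoolean.

(** * Intersections and their restrictions *)

Section Intersections.
Variable S : lsbiaType.
Implicit Types x y z e : S.

Lemma sle_scap z x y : z ⊑ x ⊓ y <-> z ⊑ x /\ z ⊑ y.
Proof.
split=> [zxy|[]]; last exact: scap_glb.
by split; apply: sle_trans zxy _; [apply: scap_lel|apply: scap_ler].
Qed.

Lemma scapxx x : x ⊓ x = x.
Proof.
by apply: sle_anti; [apply: scap_lel|apply/sle_scap; split; apply: sle_refl].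
Qed.

Lemma scap0x x : szero ⊓ x = szero.
Proof. by have [<- _] := scap_lel szero x; rewrite smeetx0. Qed.

Lemma scapx0 x : x ⊓ szero = szero.
Proof. by have [<- _] := scap_ler x szero; rewrite smeetx0. Qed.

(** From right to left: a lower bound [z] of [x ⋏ e] and [y ⋏ e] lies below [x ⊓ y] and satisfies
    [z ⋏ e = z], so monotonicity of restriction puts it below [(x ⊓ y) ⋏ e]. *)
Lemma scap_meetl x y e : (x ⊓ y) ⋏ e = (x ⋏ e) ⊓ (y ⋏ e).
Proof.
have le_meet u v : u ⊑ v -> u ⋏ e ⊑ v ⋏ e.
  move=> /sleE vu; apply/sleE.
  by rewrite smeetA (smeetAC v) vu -smeetA smeetxx.
apply: sle_anti.
  by apply/sle_scap; split; apply: le_meet; [apply: scap_lel|apply: scap_ler].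
set z := (x ⋏ e) ⊓ (y ⋏ e).
have zx : z ⊑ x ⋏ e := scap_lel _ _.
have zy : z ⊑ y ⋏ e := scap_ler _ _.
have ze : z ⋏ e = z.
  by case: zx => <- _; rewrite -!smeetA smeetxx.
rewrite -ze; apply: le_meet; apply/sle_scap.
by split; [apply: sle_trans zx _|apply: sle_trans zy _]; apply: sle_meet.
Qed.

(** Reduces an equation to the vanishing of two terms: an element whose difference with a lower
    bound is zero equals that bound. *)
Lemma sdiff_scap_eq0 x y :
  x ∖ (x ⊓ y) = szero -> y ∖ (x ⊓ y) = szero -> x = y.
Proof.
have half (u v : S) : u ⊑ v -> v ∖ u = szero -> v = u.
  by move=> /sleE vu v0; rewrite -[LHS](sdiff_joinl v u) v0 vu sjoin0x.
move=> /(half _ _ (scap_lel x y)) x0 /(half _ _ (scap_ler x y)) y0.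
by rewrite x0 -y0.
Qed.

Lemma sle_foldl_scap (J : eqType) (F : J -> S) z x (s : seq J) :
  z ⊑ foldl scap x [seq F i | i <- s] <->
  z ⊑ x /\ forall j, j \in s -> z ⊑ F j.
Proof.
elim: s x => [|a s IHs] x /=; first by split=> [//|[]].
rewrite IHs; split=> [[/sle_scap [zx za] zs]|[zx zs]].
  by split=> // j; rewrite inE => /predU1P [->//|/zs].
split; last by move=> j js; apply: zs; rewrite inE js orbT.
by apply/sle_scap; split=> //; apply: zs; rewrite mem_head.
Qed.

(** Starting the join at [szero] removes the special case of an empty list. *)
Lemma diff_joinsE x (l : seq S) : diff_joins x l = x ∖ foldl sjoin szero l.
Proof. by case: l => [|a l] /=; rewrite ?sdiffx0 ?sjoin0x. Qed.

End Intersections.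

(** * Restrictions and intersections of elementary elements *)

Section ElementaryElements.
Variables (I : finType) (S : lsbiaType) (x : I -> S).
Implicit Types (alpha : {set {set I}}) (A B C : {set I}) (z : S).

(** Non-emptiness matters: on the empty set [bigcap_of] takes the junk value [szero]. *)
Lemma sle_bigcap_of z B :
  B != set0 -> z ⊑ bigcap_of x B <-> forall i, i \in B -> z ⊑ x i.
Proof.
move=> /set0Pn [j jB]; rewrite /bigcap_of /image_mem.
have memB i : (i \in B) = (i \in enum B) by rewrite mem_enum.
have: j \in enum B by rewrite -memB.
case: (enum B) memB => //= a s memB _; rewrite sle_foldl_scap.
split=> [[za zs] i|zB].
  by rewrite memB inE => /predU1P [->//|/zs].
by split=> [|i si]; apply: zB; rewrite memB inE ?eqxx// si orbT.
Qed.

Lemma bigcap_of_le B i : i \in B -> bigcap_of x B ⊑ x i.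
Proof.
move=> iB; have B0 : B != set0 by apply/set0Pn; exists i.
by have /(sle_bigcap_of _ B0) := sle_refl (bigcap_of x B); apply.
Qed.

Lemma meet_elem_Q_eq0 z alpha :
  z ⋏ foldl sjoin szero (elem_Q x alpha) = szero <->
  (forall i, i \notin cover alpha -> z ⋏ x i = szero) /\
  (forall B C, B \in alpha -> C \in alpha -> B != C ->
     z ⋏ bigcap_of x (B :|: C) = szero).
Proof.
rewrite /elem_Q foldl_cat !smeet_foldl_sjoin_eq0; split.
  case=> [[_ zx] zm]; split=> [i ia|B C Ba Ca BC].
    by apply: zx; rewrite mem_enum inE.
  by apply: zm; rewrite mem_enum; apply/imset2P; exists B C; rewrite ?inE ?Ca.
case=> zx zm; split=> [|D]; first split=> [|i]; first exact: smeetx0.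
  by rewrite mem_enum inE; apply: zx.
rewrite mem_enum => /imset2P [B C Ba]; rewrite inE => /andP [Ca BC] ->.
exact: zm.
Qed.

Section Partition.
Variables (alpha : {set {set I}}) (alphaP : partition alpha (cover alpha)).

Let block_neq0 B : B \in alpha -> B != set0.
Proof. by apply: contraTneq => ->; case/and3P: alphaP. Qed.

Local Notation e := (elementary x alpha).

Lemma elementaryE A :
  e A = elem_p x alpha A ∖ foldl sjoin szero (elem_Q x alpha).
Proof. exact: diff_joinsE. Qed.

Lemma elem_p_meet A B :
  B \in alpha -> elem_p x alpha A ⋏ bigcap_of x B = elem_p x alpha A.
Proof. by move=> Ba; apply: foldl_smeet_absorb; rewrite mem_enum. Qed.

Lemma elementary_meet A B : B \in alpha -> e A ⋏ bigcap_of x B = e A.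
Proof.
move=> Ba; have [ep _] := sle_diff (elem_p x alpha A)
  (foldl sjoin szero (elem_Q x alpha)).
by rewrite elementaryE -ep -smeetA elem_p_meet.
Qed.

(** For fixed [alpha], the elements [e A] and [e B] differ only in the leading factor of their
    meets. Once [bigcap_of x B] is put in front, the factor of [A] moves to the end, where it is
    absorbed because [A] is a block. *)
Lemma meet_elementary A B :
  A \in alpha -> B \in alpha -> bigcap_of x B ⋏ e A = e B.
Proof.
move=> Aa Ba; rewrite !elementaryE smeet_diffA /elem_p foldl_smeet_meetl.
by rewrite foldl_smeet_meetr elem_p_meet.
Qed.

Lemma elementary_meet_elementary A B :
  A \in alpha -> B \in alpha -> e A ⋏ e B = e A.
Proof.
move=> Aa Ba.
by rewrite -(meet_elementary Aa Ba) smeetA elementary_meet// smeetxx.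
Qed.

Lemma elementary_le A : A \in alpha -> e A ⊑ bigcap_of x A.
Proof. by move=> Aa; apply/sleE; rewrite meet_elementary. Qed.

Lemma gen_meet_elementary A B i :
  A \in alpha -> B \in alpha -> i \in B -> x i ⋏ e A = e B.
Proof.
move=> Aa Ba /bigcap_of_le/sleE xm.
by rewrite -(meet_elementary Aa Ba) -xm smeetAC -smeetA elementary_meet.
Qed.

Lemma gen_meet_elementary0 A i : i \notin cover alpha -> x i ⋏ e A = szero.
Proof.
move=> ia; apply: smeet_eq0C.
have := sdiff_meet (elem_p x alpha A) (foldl sjoin szero (elem_Q x alpha)).
by rewrite -elementaryE => /meet_elem_Q_eq0 [+ _]; apply.
Qed.

(** A common lower bound lies below the meet of [A :|: B], which belongs to Q and is therefore
    disjoint from [e A]. *)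
Lemma elementary_cap A B :
  A \in alpha -> B \in alpha -> A != B -> e A ⊓ e B = szero.
Proof.
move=> Aa Ba AB; set z := e A ⊓ e B.
have zA : z ⊑ e A := scap_lel _ _.
have zB : z ⊑ e B := scap_ler _ _.
have [zm _] : z ⊑ bigcap_of x (A :|: B).
  apply/sle_bigcap_of => [|i].
    by rewrite setU_eq0 negb_and block_neq0.
  rewrite inE => /orP [] iAB; apply: sle_trans (bigcap_of_le iAB).
    exact: sle_trans zA (elementary_le Aa).
  exact: sle_trans zB (elementary_le Ba).
have := sdiff_meet (elem_p x alpha A) (foldl sjoin szero (elem_Q x alpha)).
rewrite -elementaryE => /meet_elem_Q_eq0 [_ /(_ _ _ Aa Ba AB) e0].
by rewrite -zm; case: zA => <- _; rewrite -smeetA e0 smeetx0.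
Qed.

(** Restricting [e A] to [z] erases Q, and every factor of the meet then fixes [z]. *)
Lemma sle_elementary z A :
  z ⊑ bigcap_of x A ->
  (forall B, B \in alpha -> z ⋏ bigcap_of x B = z) ->
  z ⋏ foldl sjoin szero (elem_Q x alpha) = szero ->
  z ⊑ e A.
Proof.
move=> /sleE mz zm /smeet_eq0C zQ; apply/sleE.
rewrite elementaryE smeet_diffl zQ sdiffx0 -foldl_smeet_meetr mz.
by apply: foldl_smeet_id => B; rewrite mem_enum; apply: zm.
Qed.

End Partition.
End ElementaryElements.

(** * Elementary elements under homomorphisms *)

Section Homomorphisms.
Variables (S T : lsbiaType) (h : S -> T).
Hypothesis homh : lsbia_hom h.

Lemma elementary_hom (I : finType) (x : I -> S) (y : I -> T)
    (alpha : {set {set I}}) (A : {set I}) :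
  (forall i, h (x i) = y i) -> h (elementary x alpha A) = elementary y alpha A.
Proof.
have hfold (op : S -> S -> S) (op' : T -> T -> T) l a :
    (forall a b, h (op a b) = op' (h a) (h b)) ->
    h (foldl op a l) = foldl op' (h a) (map h l).
  by move=> hop; elim: l a => //= b l IHl a; rewrite IHl hop.
have [hm hj hd hc h0] := homh => hxy.
have hcap B : h (bigcap_of x B) = bigcap_of y B.
  rewrite /bigcap_of /image_mem; case: (enum _) => //= a s.
  rewrite (hfold _ _ _ _ hc) hxy -map_comp; congr foldl.
  exact: eq_map.
rewrite !elementaryE hd /elem_p (hfold _ _ _ _ hm) (hfold _ _ _ _ hj) hcap h0.
rewrite /elem_Q /image_mem map_cat -!map_comp.
congr (_ ∖ _); first by congr foldl; apply: eq_map.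
by congr foldl; congr (_ ++ _); apply: eq_map.
Qed.

End Homomorphisms.

Lemma sval_hom (I : Type) (S : lsbiaType) (x : I -> S) :
  lsbia_hom (sval : subalg x -> S).
Proof. by []. Qed.

(** * Primitive algebras and a non-zero value for each pointed partition *)

Definition primitive (Z : Type) : Type := option Z.

Section Primitive.
Variable Z : eqType.
Implicit Types a b c d : primitive Z.

(** [None] is the zero. Among non-zero elements the meet keeps the left argument and the join the
    right one, so they form a single Green class. *)
Definition primitive_meet a b : primitive Z := if b is Some _ then a else None.
Definition primitive_join a b : primitive Z := if b is Some _ then b else a.
Definition primitive_diff a b : primitive Z := if b is Some _ then None else a.
Definition primitive_cap a b : primitive Z :=
  if (a : option Z) == b then a else None.

Local Notation m := primitive_meet.
Local Notation j := primitive_join.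

Fact primitive_meetA : associative m. Proof. by move=> [?|] [?|] [?|]. Qed.
Fact primitive_joinA : associative j. Proof. by move=> [?|] [?|] [?|]. Qed.
Fact primitive_join_meetK a b : j a (m a b) = a.
Proof. by case: a b => [?|] [?|]. Qed.
Fact primitive_join_meetKr a b : j (m b a) a = a.
Proof. by case: a b => [?|] [?|]. Qed.
Fact primitive_meet_joinK a b : m a (j a b) = a.
Proof. by case: a b => [?|] [?|]. Qed.
Fact primitive_meet_joinKr a b : m (j b a) a = a.
Proof. by case: a b => [?|] [?|]. Qed.
Fact primitive_meetDr a b c : m a (j b c) = j (m a b) (m a c).
Proof. by case: a b c => [?|] [?|] [?|]. Qed.
Fact primitive_meetDl a b c : m (j b c) a = j (m b a) (m c a).
Proof. by case: a b c => [?|] [?|] [?|]. Qed.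
Fact primitive_joinx0 a : j a None = a. Proof. by []. Qed.
Fact primitive_join0x a : j None a = a. Proof. by case: a. Qed.
Fact primitive_meetx0 a : m a None = None. Proof. by []. Qed.
Fact primitive_meet0x a : m None a = None. Proof. by case: a. Qed.
Fact primitive_diff_meet a b : m (primitive_diff a b) b = None.
Proof. by case: a b => [?|] [?|]. Qed.
Fact primitive_meet_diff a b : m b (primitive_diff a b) = None.
Proof. by case: a b => [?|] [?|]. Qed.
Fact primitive_diff_join a b : j (primitive_diff a b) (m (m a b) a) = a.
Proof. by case: a b => [?|] [?|]. Qed.
Fact primitive_join_diff a b : j (m (m a b) a) (primitive_diff a b) = a.
Proof. by case: a b => [?|] [?|]. Qed.
Fact primitive_meet_normal a b c d : m (m (m a b) c) d = m (m (m a c) b) d.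
Proof. by case: a b c d => [?|] [?|] [?|] [?|]. Qed.

HB.instance Definition _ := isSkewBoolean.Build (primitive Z)
  primitive_meetA primitive_joinA primitive_join_meetK primitive_join_meetKr
  primitive_meet_joinK primitive_meet_joinKr primitive_meetDr primitive_meetDl
  primitive_joinx0 primitive_join0x primitive_meetx0 primitive_meet0x
  primitive_diff_meet primitive_meet_diff primitive_diff_join
  primitive_join_diff primitive_meet_normal.

Fact primitive_meet_left a b : a ⋏ b ⋏ a = a ⋏ b.
Proof. by case: a b => [?|] [?|]. Qed.
Fact primitive_join_left a b : a ⋎ b ⋎ a = b ⋎ a.
Proof. by case: a b => [?|] [?|]. Qed.

HB.instance Definition _ :=
  isLeftHanded.Build (primitive Z) primitive_meet_left primitive_join_left.

Lemma primitive_leE a b : a ⊑ b <-> a = None \/ a = b.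
Proof.
case: a b => [z|] [t|]; split; try by [case|left|case=> //; case].
by case=> _ [->]; right.
Qed.

Fact primitive_cap_lel a b : primitive_cap a b ⊑ a.
Proof.
by apply/primitive_leE; rewrite /primitive_cap; case: eqP; [right|left].
Qed.
Fact primitive_cap_ler a b : primitive_cap a b ⊑ b.
Proof.
by apply/primitive_leE; rewrite /primitive_cap; case: eqP; [right|left].
Qed.
Fact primitive_cap_glb a b c : c ⊑ a -> c ⊑ b -> c ⊑ primitive_cap a b.
Proof.
move=> /primitive_leE [->|->] /primitive_leE bP; apply/primitive_leE.
  by left.
by case: bP => ->; [left|rewrite /primitive_cap eqxx; right].
Qed.

HB.instance Definition _ := hasIntersections.Build (primitive Z)
  primitive_cap_lel primitive_cap_ler primitive_cap_glb.

End Primitive.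

Definition block_point (I : finType) (alpha : {set {set I}}) (i : I) :
    primitive {set I} :=
  if i \in cover alpha then Some (pblock alpha i) else None.

Lemma elementary_block_point_neq0 (I : finType) (alpha : {set {set I}})
    (A : {set I}) :
  pointed_partition alpha A ->
  elementary (block_point alpha) alpha A <> szero.
Proof.
move=> /andP [alphaP Aa]; set v := block_point alpha.
have [_ trI _] := and3P alphaP.
have vB B i : B \in alpha -> i \in B -> v i = Some B.
  move=> Ba iB; rewrite /v /block_point (def_pblock trI Ba iB).
  by have -> : i \in cover alpha by apply/bigcupP; exists B.
have B0 B : B \in alpha -> B != set0.
  by apply: contraTneq => ->; case/and3P: alphaP.
have mB B : B \in alpha -> (Some B : primitive {set I}) ⊑ bigcap_of v B.
  move=> Ba; apply/sle_bigcap_of => [|i iB]; first exact: B0.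
  by rewrite (vB B i Ba iB); apply: sle_refl.
(* The order is flat, so an element above [Some A] equals [Some A]. *)
suff /primitive_leE [] : (Some A : primitive {set I}) ⊑ elementary v alpha A.
- by [].
- by move=> <-.
apply: sle_elementary => [|B Ba|]; first exact: mB.
  by have /primitive_leE [|<-] := mB B Ba.
apply/meet_elem_Q_eq0; split=> [i /negPf ia|B C Ba Ca BC].
  by rewrite /v /block_point ia.
have [i iB] := set0Pn _ (B0 B Ba); have [k kC] := set0Pn _ (B0 C Ca).
(* If [w] were non-zero, it would equal both [Some B] and [Some C]. *)
set w := bigcap_of v _.
have /primitive_leE [->//|wB] : w ⊑ v i by apply: bigcap_of_le; rewrite inE iB.
have /primitive_leE [->//|] : w ⊑ v k.
  by apply: bigcap_of_le; rewrite inE kC orbT.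
by rewrite wB (vB B)// (vB C)// => -[/eqP]; rewrite (negPf BC).
Qed.

(** * Terms and their values *)

Inductive term (I : Type) : Type :=
| Gen (i : I)
| Zero
| Meet (s t : term I)
| Join (s t : term I)
| Diff (s t : term I)
| Cap (s t : term I).
Arguments Zero {I}.

Fixpoint eval (I : Type) (S : lsbiaType) (x : I -> S) (t : term I) : S :=
  match t with
  | Gen i => x i
  | Zero => szero
  | Meet s t => eval x s ⋏ eval x t
  | Join s t => eval x s ⋎ eval x t
  | Diff s t => eval x s ∖ eval x t
  | Cap s t => eval x s ⊓ eval x t
  end.

Lemma eval_hom (I : Type) (S T : lsbiaType) (h : S -> T) (x : I -> S)
    (y : I -> T) (t : term I) :
  lsbia_hom h -> (forall i, h (x i) = y i) -> h (eval x t) = eval y t.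
Proof.
case=> hm hj hd hc h0 hxy.
by elim: t => //= s IHs t IHt; rewrite ?hm ?hj ?hd ?hc IHs IHt.
Qed.

Lemma generated_eval (I : Type) (S : lsbiaType) (x : I -> S) (s : S) :
  generated x s -> exists t, eval x t = s.
Proof.
elim=> {s} [i||a b _ [s <-] _ [t <-]|a b _ [s <-] _ [t <-]
           |a b _ [s <-] _ [t <-]|a b _ [s <-] _ [t <-]].
- by exists (Gen i).
- by exists Zero.
- by exists (Meet s t).
- by exists (Join s t).
- by exists (Diff s t).
- by exists (Cap s t).
Qed.

(** * Elements that decide all generators, and the values of terms on them *)

Section Decides.
Variables (I : Type) (S : lsbiaType) (x : I -> S).
Implicit Types (w e : S).

(** The case [i = j] concerns single generators, since [x i ⊓ x i = x i]. *)
Definition decides e : Prop :=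
  forall i j, e ⋏ (x i ⊓ x j) = szero \/ e ⋏ (x i ⊓ x j) = e.

Section Decided.
Variables (e : S) (dec_e : decides e).

Lemma decides_meet i : x i ⋏ e <> szero -> e ⋏ (x i ⋏ e) = e.
Proof.
have := dec_e i i; rewrite scapxx => -[/smeet_eq0C-> //|ei _].
by rewrite smeetA ei smeetxx.
Qed.

Lemma decides_cap i j : x i ⋏ e <> x j ⋏ e -> (x i ⋏ e) ⊓ (x j ⋏ e) = szero.
Proof.
rewrite -scap_meetl => ij; case: (dec_e i j) => [/smeet_eq0C//|eij].
have half k : x i ⊓ x j ⊑ x k -> x k ⋏ e = (x i ⊓ x j) ⋏ e.
  move=> /sleE <-; rewrite smeetAC -smeetA.
  by rewrite eij.
case: ij; rewrite half; last exact: scap_lel.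
by rewrite half//; apply: scap_ler.
Qed.

End Decided.
End Decides.

(** Go through the list, replacing [e] by [e ⋏ y a] whenever this is non-zero. By [smeetAC], earlier
    decisions survive the shrinking. *)
Lemma refine_neq0 (S : lsbiaType) (J : eqType) (y : J -> S) (s : seq J)
    (w : S) :
  w <> szero ->
  exists e, [/\ e <> szero, e ⊑ w
    & forall k, k \in s -> e ⋏ y k = szero \/ e ⋏ y k = e].
Proof.
move=> w0; elim: s => [|a s [e [e0 ew es]]].
  by exists w; split=> //; apply: sle_refl.
have [ea0|ea0] := EM (e ⋏ y a = szero).
  by exists e; split=> // k; rewrite inE => /predU1P [->|/es]; first by left.
exists (e ⋏ y a); split=> //; first exact: sle_trans (sle_meet _ _) ew.
move=> k; rewrite inE => /predU1P [->|/es].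
  by right; rewrite -smeetA smeetxx.
by rewrite smeetAC => -[] ->; [left; rewrite smeet0x|right].
Qed.

(** Zero and the restrictions of the generators to a deciding element are closed under the
    operations, as in a primitive algebra. Which of them an operation returns depends only on which
    restrictions vanish and which coincide, and this pattern is the same for [x] on [e] and [y] on
    [w]. *)
Lemma eval_decided (I : Type) (S T : lsbiaType) (x : I -> S) (y : I -> T)
    (e : S) (w : T) :
  decides x e -> decides y w ->
  (forall i, x i ⋏ e = szero <-> y i ⋏ w = szero) ->
  (forall i j, x i ⋏ e = x j ⋏ e <-> y i ⋏ w = y j ⋏ w) ->
  forall t, (eval x t ⋏ e = szero /\ eval y t ⋏ w = szero) \/
    exists i, [/\ x i ⋏ e <> szero, eval x t ⋏ e = x i ⋏ e
                & eval y t ⋏ w = y i ⋏ w].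
Proof.
move=> dec_e dec_w eq0 eqij.
have meetD (U : lsbiaType) (a b c : U) : (a ⋏ b) ⋏ c = (a ⋏ c) ⋏ (b ⋏ c).
  by rewrite smeetA (smeetAC a c) -(smeetA _ c c) smeetxx.
(* Non-zero restrictions share the Green class of [e], so multiplying by them on the right changes
   nothing. *)
have absS i j : x j ⋏ e <> szero -> (x i ⋏ e) ⋏ (x j ⋏ e) = x i ⋏ e.
  by move=> j0; rewrite -smeetA decides_meet.
have absT i j : x j ⋏ e <> szero -> (y i ⋏ w) ⋏ (y j ⋏ w) = y i ⋏ w.
  by rewrite eq0 => j0; rewrite -smeetA decides_meet.
elim=> [i||s IHs t IHt|s IHs t IHt|s IHs t IHt|s IHs t IHt] /=.
- have [xi0|xi0] := EM (x i ⋏ e = szero); last by right; exists i.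
  by left; split=> //; apply/eq0.
- by left; rewrite !smeet0x.
- rewrite (meetD _ _ _ e) (meetD _ _ _ w).
  case: IHs => [[-> ->]|[i [xi -> ->]]]; first by left; rewrite !smeet0x.
  case: IHt => [[-> ->]|[j [xj -> ->]]]; first by left; rewrite !smeetx0.
  by right; exists i; rewrite absS ?absT.
- rewrite !smeetDl; case: IHs => [[-> ->]|[i [xi -> ->]]].
    by rewrite !sjoin0x.
  case: IHt => [[-> ->]|[j [xj -> ->]]].
    by right; exists i; rewrite !sjoinx0.
  by right; exists j; rewrite !sjoin_eqr ?absS ?absT.
- rewrite !smeet_diffl; case: IHs => [[-> ->]|[i [xi -> ->]]].
    by left; rewrite !sdiff_eq0 ?smeet0x.
  case: IHt => [[-> ->]|[j [xj -> ->]]].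
    by right; exists i; rewrite !sdiffx0.
  by left; rewrite !sdiff_eq0 ?absS ?absT.
- rewrite !scap_meetl; case: IHs => [[-> ->]|[i [xi -> ->]]].
    by left; rewrite !scap0x.
  case: IHt => [[-> ->]|[j [xj -> ->]]]; first by left; rewrite !scapx0.
  have [ij|ij] := EM (x i ⋏ e = x j ⋏ e).
    right; exists i; rewrite -ij scapxx; split=> //.
    by move/eqij: ij => <-; rewrite scapxx.
  left; rewrite !decides_cap//.
  by move=> /eqij.
Qed.

(** * Recovering a pointed partition from its non-zero elementary element *)

Definition meet_partition (I : finType) (S : lsbiaType) (x : I -> S) (e : S) :
    {set {set I}} :=
  preim_partition (fun i => x i ⋏ e : {classic S})
    [set i | (x i ⋏ e : {classic S}) != szero].

Section NonzeroElementary.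
Variables (I : finType) (S : lsbiaType) (x : I -> S) (alpha : {set {set I}}).
Hypothesis alphaP : partition alpha (cover alpha).
Variables (A : {set I}) (Aa : A \in alpha).

Local Notation e := (elementary x alpha).
Hypothesis eA0 : e A <> szero.

Lemma elementary_neq0 B : B \in alpha -> e B <> szero.
Proof.
move=> Ba eB0; apply: eA0.
by rewrite -(elementary_meet_elementary x Aa Ba) eB0 smeetx0.
Qed.

(** Equal values at distinct blocks would have intersection zero and hence be zero. *)
Lemma elementary_inj : {in alpha &, injective e}.
Proof.
move=> B C Ba Ca eBC; apply/eqP/contraT => BC.
case: (elementary_neq0 Ba); rewrite -(elementary_cap x alphaP Ba Ca BC).
by rewrite -eBC scapxx.
Qed.

Lemma cover_elementary i : (i \in cover alpha) <-> x i ⋏ e A <> szero.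
Proof.
split=> [/bigcupP [B Ba iB]|xi0].
  by rewrite (gen_meet_elementary x Aa Ba iB); apply: elementary_neq0.
by apply: contra_notT xi0; apply: gen_meet_elementary0.
Qed.

Lemma gen_meet_pblock i : i \in cover alpha -> x i ⋏ e A = e (pblock alpha i).
Proof.
by move=> ia; apply: gen_meet_elementary; rewrite ?pblock_mem ?mem_pblock.
Qed.

Lemma pblock_elementary i j : i \in cover alpha -> j \in cover alpha ->
  x i ⋏ e A = x j ⋏ e A <-> pblock alpha i = pblock alpha j.
Proof.
move=> ia ja; rewrite !gen_meet_pblock//; split=> [|->//].
by apply: elementary_inj; apply: pblock_mem.
Qed.

Lemma elementary_decides : decides x (e A).
Proof.
(* Left-handedness supplies a second factor [e A], to which both generators are restricted. *)
move=> i j; rewrite -(smeet_left (e A)) -smeetA scap_meetl.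
have [ia|/gen_meet_elementary0->] := boolP (i \in cover alpha); last first.
  by left; rewrite scap0x smeetx0.
have [ja|/gen_meet_elementary0->] := boolP (j \in cover alpha); last first.
  by left; rewrite scapx0 smeetx0.
rewrite !gen_meet_pblock//.
have [<-|ij] := eqVneq (pblock alpha i) (pblock alpha j).
  by right; rewrite scapxx elementary_meet_elementary ?pblock_mem.
by left; rewrite elementary_cap ?smeetx0 ?pblock_mem.
Qed.

(** The right-hand side involves the pointed partition only through the element [e A], so equal
    non-zero elementary elements have equal distinguished blocks; [partition_elementary] does the
    same for [alpha]. *)
Lemma block_elementary : A = [set i | (x i ⋏ e A : {classic S}) == e A].
Proof.
apply/setP=> i; rewrite inE; apply/idP/eqP => [iA|xi].
  exact: gen_meet_elementary.
have ia : i \in cover alpha by apply/cover_elementary; rewrite xi.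
move: xi; rewrite gen_meet_pblock// => /elementary_inj <-//.
  by rewrite mem_pblock.
exact: pblock_mem.
Qed.

Lemma partition_elementary : alpha = meet_partition x (e A).
Proof.
rewrite -[LHS](preim_partition_pblock alphaP) /meet_partition.
have -> : [set i | (x i ⋏ e A : {classic S}) != szero] = cover alpha.
  apply/setP=> i; rewrite inE; apply/idP/idP => [/eqP/cover_elementary//|ia].
  exact/eqP/cover_elementary.
apply: eq_in_imset => i ia; apply/setP=> j; rewrite !inE.
by apply: andb_id2l => ja; apply/eqP/eqP => /(pblock_elementary ia ja).
Qed.

End NonzeroElementary.

(** * Freeness from non-zero elementary elements *)

Section Freeness.
Variables (I : finType) (S : lsbiaType) (x : I -> S).
Hypothesis x_neq0 : forall (alpha : {set {set I}}) (A : {set I}),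
  pointed_partition alpha A -> elementary x alpha A <> szero.

Lemma eval_eq0 (T : lsbiaType) (f : I -> T) (t : term I) :
  eval x t = szero -> eval f t = szero.
Proof.
move=> xt0; apply: contrapT => ft0.
have [w [w0 wt w_dec]] :=
  refine_neq0 (fun p : I * I => f p.1 ⊓ f p.2) (enum {: I * I}) ft0.
have dec_w : decides f w by move=> i j; apply: (w_dec (i, j)); rewrite mem_enum.
set D := [set i | (f i ⋏ w : {classic T}) != szero].
have DP i : i \in D <-> f i ⋏ w <> szero.
  by rewrite inE; split=> [/eqP//|fi0]; apply/eqP.
set alpha := meet_partition f w.
have alphaD : partition alpha D := preim_partitionP _ _.
have coverD : cover alpha = D := cover_partition alphaD.
have alphaP : partition alpha (cover alpha) by rewrite coverD.
have [_ trI _] := and3P alphaP.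
have pblockP i j : i \in D -> j \in D ->
    pblock alpha i = pblock alpha j <-> f i ⋏ w = f j ⋏ w.
  move=> iD jD; have -> : (f i ⋏ w = f j ⋏ w) <-> j \in pblock alpha i.
    rewrite pblock_equivalence_partition//; last by split=> // /eqP->.
    by split=> [fij|/eqP//]; apply/eqP.
  by rewrite -eq_pblock ?coverD//; split=> /eqP.
have eval_w : eval f t ⋏ w = w by apply/sleE.
(* Comparing [f] on [w] with itself yields a generator that is non-zero on [w], hence a block to
   serve as [A]; otherwise [eval f t ⋏ w], which is [w], would be zero. *)
have [[+ _]|[i [fi0 _ _]]] := eval_decided dec_w dec_w
  (fun=> iff_refl _) (fun _ _ => iff_refl _) t; first by rewrite eval_w.
have Aa : pblock alpha i \in alpha by rewrite pblock_mem// coverD; apply/DP.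
set A := pblock alpha i in Aa *.
have eA0 : elementary x alpha A <> szero.
  by apply: x_neq0; rewrite /pointed_partition alphaP.
have xD k : k \in D <-> x k ⋏ elementary x alpha A <> szero.
  by rewrite -coverD; apply: cover_elementary.
have x0D k : x k ⋏ elementary x alpha A = szero <-> f k ⋏ w = szero.
  by split=> k0; apply: contrapT; [move=> /DP/xD|move=> /xD/DP].
have xfD j k : x j ⋏ elementary x alpha A = x k ⋏ elementary x alpha A <->
    f j ⋏ w = f k ⋏ w.
  (* Outside [D] both restrictions vanish, which reduces the comparison to [x0D]. *)
  have notD l : l \notin D ->
      f l ⋏ w = szero /\ x l ⋏ elementary x alpha A = szero.
    move=> lD; suff fl0 : f l ⋏ w = szero by split=> //; apply/x0D.
    by apply: contrapT => /DP; apply/negP.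
  have [kD|/notD [-> ->]] := boolP (k \in D); last exact: x0D.
  have [jD|/notD [-> ->]] := boolP (j \in D); last by split=> /esym/x0D.
  by rewrite -pblockP// pblock_elementary// coverD.
(* Now [x] on the elementary element is compared with [f] on [w]: the zero case contradicts
   [w <> szero], the generator case contradicts [eval x t = szero]. *)
have [[_ +]|[k [xk0 + _]]] := eval_decided (elementary_decides x alphaP Aa)
  dec_w x0D xfD t; first by rewrite eval_w.
by rewrite xt0 smeet0x => /esym.
Qed.

Lemma eq_eval (T : lsbiaType) (f : I -> T) (s t : term I) :
  eval x s = eval x t -> eval f s = eval f t.
Proof.
move=> xst; apply: sdiff_scap_eq0.
  apply: (@eval_eq0 _ _ (Diff s (Cap s t))).
  by rewrite /= xst scapxx sdiff_eq0 ?smeetxx.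
apply: (@eval_eq0 _ _ (Diff t (Cap s t))).
by rewrite /= xst scapxx sdiff_eq0 ?smeetxx.
Qed.

(** The extension of [f] evaluates at [f] a chosen term representing the given element; by [eq_eval]
    the choice of term does not affect the value. *)
Lemma elementary_neq0_free : free_over (subalg_gen x).
Proof.
move=> T f; pose code (s : subalg x) := sval (cid (generated_eval (svalP s))).
have codeP s : eval x (code s) = sval s by rewrite /code; case: cid.
have codeE s t : eval x t = sval s -> eval f (code s) = eval f t.
  by move=> ts; apply: eq_eval; rewrite codeP.
exists (fun s => eval f (code s)); split.
- split=> [a b|a b|a b|a b|].
  + by rewrite (codeE _ (Meet (code a) (code b)))//= !codeP.
  + by rewrite (codeE _ (Join (code a) (code b)))//= !codeP.
  + by rewrite (codeE _ (Diff (code a) (code b)))//= !codeP.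
  + by rewrite (codeE _ (Cap (code a) (code b)))//= !codeP.
  + by rewrite (codeE _ Zero).
- by move=> i; rewrite (codeE _ (Gen i)).
(* Uniqueness: any extension commutes with evaluation, and the chosen term evaluates to [s] inside
   the subalgebra. *)
move=> h homh hx s; rewrite -(eval_hom _ homh hx); congr h.
by apply: subalg_inj; rewrite (eval_hom _ (sval_hom x) (y := x)).
Qed.

End Freeness.

(** * Non-vanishing from freeness, and the equivalences *)

Lemma free_elementary_neq0 (I : finType) (S : lsbiaType) (x : I -> S)
    (alpha : {set {set I}}) (A : {set I}) :
  free_over (subalg_gen x) -> pointed_partition alpha A ->
  elementary x alpha A <> szero.
Proof.
move=> free_x pA e0; have [h [homh hx _]] := free_x _ (block_point alpha).
apply: (elementary_block_point_neq0 pA); rewrite -(elementary_hom homh _ _ hx).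
suff -> : elementary (subalg_gen x) alpha A = szero by apply: hom_zero homh.
by apply: subalg_inj; rewrite (elementary_hom (sval_hom x) (y := x)).
Qed.

Theorem proposition24 (n : nat) (n_ge1 : 1 <= n) (S : lsbiaType)
    (x : 'I_n -> S) (x_inj : injective x) :
  let free_generated := free_over (subalg_gen x) in
  let all_nonzero :=
    forall (alpha : {set {set 'I_n}}) (A : {set 'I_n}),
      pointed_partition alpha A -> elementary x alpha A <> szero in
  let pairwise_distinct :=
    forall (alpha : {set {set 'I_n}}) (A : {set 'I_n})
           (beta : {set {set 'I_n}}) (B : {set 'I_n}),
      pointed_partition alpha A -> pointed_partition beta B ->
      (alpha, A) <> (beta, B) ->
      elementary x alpha A <> elementary x beta B in
  (free_generated <-> all_nonzero) /\
  (all_nonzero <-> all_nonzero /\ pairwise_distinct).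
Proof.
cbv zeta; split.
  split=> [free_x alpha A|x_neq0]; first exact: free_elementary_neq0.
  exact: elementary_neq0_free.
split=> [x_neq0|[]//].
split=> // alpha A beta B pA pB neq eAB; apply: neq.
have [/andP [aP Aa] /andP [bP Bb]] := (pA, pB).
have [eA0 eB0] := (x_neq0 _ _ pA, x_neq0 _ _ pB).
congr pair.
  by rewrite [LHS](partition_elementary aP Aa eA0) eAB -partition_elementary.
by rewrite [LHS](block_elementary aP Aa eA0) eAB -block_elementary.
Qed.
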